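(* Let $T=\{1243,3142,3412\}$. Then $$F_T(x)=\frac{1-9x+30x^2-44x^3+27x^4-7x^5}{(1-3x)(1-x)(1-3x+x^2)^2}.$$
   Context: $S_n(T)$ denotes the set of permutations $\pi$ of $[n]=\{1,\dots,n\}$ (one-line notation) that avoid every pattern $\tau\in T$, i.e. no subsequence of $\pi$ is order-isomorphic to $\tau$. $F_T(x)=\sum_{n\ge 0}|S_n(T)|x^n$, a formal power series, with $|S_0(T)|=1$. *)

(* Defs.v *)
From HB Require Import structures.
From mathcomp Require Import all_boot all_order all_fingroup all_algebra.
From mathcomp Require Import boolp.

Set Implicit Arguments.
Unset Strict Implicit.
Unset Printing Implicit Defensive.

Import GRing.Theory.
Local Open Scope ring_scope.

(* One-line notation with letters in 1..n, although 'S_n acts on 0..n-1. *)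
Definition one_line n (pi : 'S_n) : seq nat := [seq (pi i).+1 | i <- enum 'I_n].

Definition order_iso (s t : seq nat) : bool :=
  (size s == size t) &&
  [forall i : 'I_(size s), forall j : 'I_(size s),
     (nth 0 s i < nth 0 s j) == (nth 0 t i < nth 0 t j)]%N.

(* The subsequences of a word w are exactly the mask m w with size m = size w. *)
Definition contains n (pi : 'S_n) (tau : seq nat) : bool :=
  [exists m : n.-tuple bool, order_iso (mask m (one_line pi)) tau].

Definition avoiders n (T : seq (seq nat)) : {set 'S_n} :=
  [set pi : 'S_n | all (fun tau => ~~ contains pi tau) T].

(* A record rather than the bare function type nat -> R, whose library ring
   structure is pointwise. *)
Record fps (R : Type) := Fps { fcoef : nat -> R }.

Lemma fpsP (R : Type) (f g : fps R) : fcoef f =1 fcoef g -> f = g.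
Proof. by case: f g => [f] [g] /= /funext ->. Qed.

HB.instance Definition _ (R : Type) := gen_eqMixin (fps R).
HB.instance Definition _ (R : Type) := gen_choiceMixin (fps R).

Section FpsRing.
Variable R : comUnitRingType.
Implicit Types f g h : fps R.

Definition fps0 : fps R := Fps (fun _ => 0).
Definition fps1 : fps R := Fps (fun n => (n == 0%N)%:R).
Definition fpsX : fps R := Fps (fun n => (n == 1%N)%:R).
Definition fpsN f : fps R := Fps (fun n => - fcoef f n).
Definition fpsD f g : fps R := Fps (fun n => fcoef f n + fcoef g n).
Definition fpsM f g : fps R :=
  Fps (fun n => \sum_(i < n.+1) fcoef f i * fcoef g (n - i)).

Fact fpsDA : associative fpsD.
Proof. by move=> f g h; apply: fpsP => n /=; rewrite addrA. Qed.
Fact fpsDC : commutative fpsD.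
Proof. by move=> f g; apply: fpsP => n /=; rewrite addrC. Qed.
Fact fps0D : left_id fps0 fpsD.
Proof. by move=> f; apply: fpsP => n /=; rewrite add0r. Qed.
Fact fpsND : left_inverse fps0 fpsN fpsD.
Proof. by move=> f; apply: fpsP => n /=; rewrite addNr. Qed.

HB.instance Definition _ :=
  GRing.isZmodule.Build (fps R) fpsDA fpsDC fps0D fpsND.

Let trunc m f : {poly R} := \poly_(i < m) fcoef f i.

Let truncM m n f g : (n < m)%N ->
  (trunc m f * trunc m g)`_n = fcoef (fpsM f g) n.
Proof.
move=> nm; rewrite coefM; apply: eq_bigr => -[i /= lt_i] _.
by rewrite !coef_poly (leq_ltn_trans _ nm) // (leq_ltn_trans (leq_subr _ _) nm).
Qed.

Fact fpsMC : commutative fpsM.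
Proof.
by move=> f g; apply: fpsP => n; rewrite -!(truncM _ _ (ltnSn n)) mulrC.
Qed.

Fact fpsMA : associative fpsM.
Proof.
move=> f g h; apply: fpsP => n.
transitivity ((trunc n.+1 f * trunc n.+1 g * trunc n.+1 h)`_n).
  rewrite -mulrA coefM; apply: eq_bigr => -[i /= lt_i] _.
  by rewrite coef_poly lt_i truncM // ltnS leq_subr.
rewrite coefM; apply: eq_bigr => -[i /= lt_i] _.
by rewrite coef_poly ltnS leq_subr truncM.
Qed.

Fact fps1M : left_id fps1 fpsM.
Proof.
move=> f; apply: fpsP => n /=; rewrite big_ord_recl /= mul1r subn0.
by rewrite big1 ?addr0 // => i _; rewrite mul0r.
Qed.

Fact fpsMDl : left_distributive fpsM fpsD.
Proof.
move=> f g h; apply: fpsP => n /=; rewrite -big_split.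
by apply: eq_bigr => i _; rewrite mulrDl.
Qed.

Fact fps1_neq0 : fps1 != 0 :> fps R.
Proof.
by apply/eqP => /(congr1 (fun f => fcoef f 0)) /eqP; rewrite oner_eq0.
Qed.

HB.instance Definition _ := GRing.Zmodule_isComNzRing.Build (fps R)
  fpsMA fpsMC fps1M fpsMDl fps1_neq0.

Definition fps_unit : pred (fps R) := fun f => fcoef f 0 \is a GRing.unit.

(* The first n coefficients of the inverse g of f, when f has a unit constant
   term: g_n = f_0^-1 ([n = 0] - \sum_(i < n) f_(n-i) g_i). *)
Fixpoint fpsV_seq f (n : nat) : seq R :=
  if n is k.+1 then
    let s := fpsV_seq f k in
    rcons s ((fcoef f 0)^-1 *
             ((k == 0%N)%:R - \sum_(i < k) fcoef f (k - i) * s`_i))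
  else [::].

(* As for every unitRingType, the inverse of a non-unit f is f itself. *)
Definition fpsV f : fps R :=
  if fps_unit f then Fps (fun n => (fpsV_seq f n.+1)`_n) else f.

Let size_fpsV_seq f n : size (fpsV_seq f n) = n.
Proof. by elim: n => //= n IHn; rewrite size_rcons IHn. Qed.

Let nth_fpsV_seq f n i : (i < n)%N -> (fpsV_seq f n)`_i = (fpsV_seq f i.+1)`_i.
Proof.
elim: n => // n IHn; rewrite ltnS leq_eqVlt => /predU1P[-> // | lt_in].
by rewrite [fpsV_seq f n.+1]/= nth_rcons size_fpsV_seq lt_in IHn.
Qed.

Fact fpsVM : {in fps_unit, left_inverse 1 fpsV *%R}.
Proof.
move=> f uf; rewrite mulrC; apply: fpsP => n.
have uf0 : fcoef f 0 \is a GRing.unit by [].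
rewrite /fpsV ifT // mulrC.
have -> : fcoef (Fps (fun k => (fpsV_seq f k.+1)`_k) * f) n =
  \sum_(i < n.+1) (fpsV_seq f i.+1)`_i * fcoef f (n - i) by [].
rewrite big_ord_recr /= subnn nth_rcons size_fpsV_seq ltnn eqxx.
rewrite mulrC mulrA divrr // mul1r.
rewrite addrC -addrA [X in _ + X](_ : _ = 0) ?addr0 //.
apply/eqP; rewrite addrC subr_eq0; apply/eqP.
by apply: eq_bigr => -[i lt_i] _ /=; rewrite mulrC (nth_fpsV_seq _ lt_i).
Qed.

Fact fps_unitP f g : g * f = 1 -> fps_unit f.
Proof.
move=> /(congr1 (fun h => fcoef h 0)) /=; rewrite big_ord1 => gf1.
by apply/unitrPr; exists (fcoef g 0); rewrite mulrC.
Qed.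

Fact fpsV_out : {in [predC fps_unit], fpsV =1 id}.
Proof. by move=> f /negP nuf; rewrite /fpsV; case: ifP. Qed.

HB.instance Definition _ := GRing.ComNzRing_hasMulInverse.Build (fps R)
  fpsVM fps_unitP fpsV_out.

End FpsRing.

Arguments fpsX {R}.

Definition avoid_gf (T : seq (seq nat)) : fps int :=
  Fps (fun n => #|avoiders n T|%:R).

(* Main.v *)
Require Import Defs.
From mathcomp Require Import all_boot all_order all_fingroup all_algebra.
From mathcomp Require Import zify ring.

Set Implicit Arguments.
Unset Strict Implicit.
Unset Printing Implicit Defensive.

Import GRing.Theory.

(**
Passing to inverses, one counts the permutations avoiding 1243, 2413 and 3412,
and these are grown by appending a last letter: a permutation of size n has
n + 1 gaps where the value of the new letter may be inserted, and a gap is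
active if the insertion creates no forbidden pattern.  In the decreasing
permutation every gap is active.  After the first ascent the active gaps, from
the lowest to the highest value, always form a list N^i C E^e P^j, where the
gap C is marked or not, and an insertion changes this list as follows:
- into the t-th N gap (t = 0, ..., i - 1): N^t C P^j with C unmarked;
- into C: nothing changes if C is unmarked; if it is marked, one E is added;
- into an E gap: the E gaps below it disappear and C becomes unmarked;
- into a P gap: all E gaps and the P gaps below it disappear and C becomes
  unmarked.
From the decreasing permutation of size n one reaches a decreasing permutation
or, in one way for each i in 1, ..., n, a list N^i C P^(n+1-i) with C marked.
Let M(i,e,j) and D(i,e,j) be the generating functions of the number of ways of
growing a list with unmarked or marked C.  Then M(i,e,j) is geometric in e,
which gives (1 - 3x + x^2) D(i,0,j) = (1 - x)(1 - 2x) M(i,0,j), and summing the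
equations for M(i,0,j) over i and j gives
sum_(i,j) x^(i+j) M(i,0,j+1) = 1 / ((1 - x)(1 - 3x)) and
sum_j x^j M(0,0,j+1) = 1 / (1 - 3x + x^2).
*)

(** * Words and gaps *)

Local Open Scope nat_scope.

(** The recursion extends that of [pairwise], so that appending a letter to a word splits off
    exactly the tuples that end at this letter. *)
Fixpoint triplewise (T : Type) (r : T -> T -> T -> bool) (s : seq T) : bool :=
  if s is x :: s' then pairwise (r x) s' && triplewise r s' else true.

Fixpoint quadwise (T : Type) (r : T -> T -> T -> T -> bool) (s : seq T) :=
  if s is x :: s' then triplewise (r x) s' && quadwise r s' else true.

Lemma triplewise_rcons T (r : T -> T -> T -> bool) s z :
  triplewise r (rcons s z) = triplewise r s && pairwise (fun x y => r x y z) s.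
Proof.
elim: s => //= x s ->; rewrite pairwise_rcons.
by rewrite [all _ _ && pairwise _ _]andbC !andbA;
  congr andb; rewrite -!andbA; congr andb; rewrite andbC.
Qed.

Lemma quadwise_rcons T (r : T -> T -> T -> T -> bool) s z :
  quadwise r (rcons s z) =
  quadwise r s && triplewise (fun x y t => r x y t z) s.
Proof.
elim: s => //= x s ->; rewrite triplewise_rcons.
by rewrite !andbA; congr andb; rewrite -!andbA; congr andb; rewrite andbC.
Qed.

Lemma triplewise_map T U (f : T -> U) (r : U -> U -> U -> bool) s :
  triplewise r (map f s) = triplewise (fun x y z => r (f x) (f y) (f z)) s.
Proof. by elim: s => //= x s ->; rewrite pairwise_map. Qed.

Lemma quadwise_map T U (f : T -> U) (r : U -> U -> U -> U -> bool) s :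
  quadwise r (map f s) =
  quadwise (fun x y z t => r (f x) (f y) (f z) (f t)) s.
Proof. by elim: s => //= x s ->; rewrite triplewise_map. Qed.

Lemma eq_pairwise_seq T (r r' : rel T) s :
  (forall x y, r x y = r' x y) -> pairwise r s = pairwise r' s.
Proof. exact: (@eq_pairwise T r r' ^~ s). Qed.

Lemma eq_triplewise T (r r' : T -> T -> T -> bool) s :
  (forall x y z, r x y z = r' x y z) -> triplewise r s = triplewise r' s.
Proof. by move=> e; elim: s => //= x s ->; rewrite (eq_pairwise_seq s (e x)). Qed.

Lemma eq_quadwise T (r r' : T -> T -> T -> T -> bool) s :
  (forall x y z t, r x y z t = r' x y z t) -> quadwise r s = quadwise r' s.
Proof. by move=> e; elim: s => //= x s ->; rewrite (eq_triplewise s (e x)). Qed.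

Lemma pairwiseS (T : eqType) (r : rel T) s :
  reflect (forall x y, subseq [:: x; y] s -> r x y) (pairwise r s).
Proof.
elim: s => [|u s IHs]; first by left.
rewrite pairwise_cons; apply: (iffP andP) => [[/allP ru /IHs rs] x y /=|rs].
  by case: eqP => [-> | _] ; [rewrite sub1seq => /ru | move=> /rs].
split; first by apply/allP => y ys; apply: rs; rewrite /= eqxx sub1seq.
by apply/IHs => x y xys; apply: rs; apply: subseq_trans xys (subseq_cons _ _).
Qed.

Lemma triplewiseS (T : eqType) (r : T -> T -> T -> bool) s :
  reflect (forall x y z, subseq [:: x; y; z] s -> r x y z) (triplewise r s).
Proof.
elim: s => [|u s IHs]; first by left.
apply: (iffP andP) => [[/pairwiseS ru /IHs rs] x y z /=|rs].
  by case: eqP => [-> | _] ; [move=> /ru | move=> /rs].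
split; first by apply/pairwiseS => y z yz; apply: rs; rewrite /= eqxx.
by apply/IHs => x y z h; apply: rs; apply: subseq_trans h (subseq_cons _ _).
Qed.

Lemma quadwiseS (T : eqType) (r : T -> T -> T -> T -> bool) s :
  reflect (forall x y z t, subseq [:: x; y; z; t] s -> r x y z t)
          (quadwise r s).
Proof.
elim: s => [|u s IHs]; first by left.
apply: (iffP andP) => [[/triplewiseS ru /IHs rs] x y z t /=|rs].
  by case: eqP => [-> | _] ; [move=> /ru | move=> /rs].
split; first by apply/triplewiseS => y z t yzt; apply: rs; rewrite /= eqxx.
by apply/IHs => x y z t h; apply: rs; apply: subseq_trans h (subseq_cons _ _).
Qed.

(* [a; b; c; d] is not order-isomorphic to 1243, 2413 or 3412, the inverses of
   1243, 3142 and 3412. *)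
Definition good4 (a b c d : nat) : bool :=
  ~~ [|| (a < b) && (b < d) && (d < c),
         (c < a) && (a < d) && (d < b) | (c < d) && (d < a) && (a < b)].

Definition avoids (w : seq nat) : bool := quadwise good4 w.

Definition append (v : nat) (w : seq nat) : seq nat := rcons (map (bump v) w) v.

(* Gap g lies between the values g - 1 and g, so the letters a < g are below a
   letter inserted there.  [active w g] says that no forbidden pattern ends at
   the inserted letter. *)
Definition active (w : seq nat) (g : nat) : bool :=
  triplewise (fun a b c => ~~ [|| (a < b) && (b < g) && (g <= c),
    (c < a) && (a < g) && (g <= b) | (c < g) && (g <= a) && (a < b)]) w.

(** These three tests find the pairs that a further letter turns into the first three letters of a
    forbidden pattern whose last letter would go into gap g. A letter above g does so with an ascent
    below g (1243); a letter u below g does so with an ascent above g (3412), or with a letter of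
    [u, g) followed by one above g (2413). *)
Definition lows_dec (w : seq nat) (g : nat) : bool :=
  pairwise (fun a b => ~~ ((a < b) && (b < g))) w.

Definition highs_dec (w : seq nat) (g : nat) : bool :=
  pairwise (fun a b => ~~ ((g <= a) && (a < b))) w.

Definition lows_first_lt (w : seq nat) (g u : nat) : bool :=
  pairwise (fun a b => ~~ [&& u <= a, a < g & g <= b]) w.

Definition standard (w : seq nat) : bool := perm_eq w (iota 0 (size w)).

(** * Effect of an appended letter on the tests *)

Lemma ltn_bump2 v a b : (bump v a < bump v b) = (a < b).
Proof. by rewrite !ltnNge leq_bump2. Qed.

(** Appending v splits gap v into gaps v and v + 1. Gaps g <= v keep their number and gaps g >= v
    become g + 1; the suffixes [lo] and [hi] denote these two cases, which overlap at the two halves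
    of gap v. *)
Lemma bump_lt_lo v g a : g <= v -> (bump v a < g) = (a < g).
Proof. by rewrite /bump; case: (leqP v a); lia. Qed.

Lemma bump_lt_hi v g a : v <= g -> (bump v a < g.+1) = (a < g).
Proof. by rewrite /bump; case: (leqP v a); lia. Qed.

Lemma leq_bump_lo v g a : g <= v -> (g <= bump v a) = (g <= a).
Proof. by rewrite /bump; case: (leqP v a); lia. Qed.

Lemma leq_bump_hi v g a : v <= g -> (g < bump v a) = (g <= a).
Proof. by rewrite /bump; case: (leqP v a); lia. Qed.

Lemma size_append v w : size (append v w) = (size w).+1.
Proof. by rewrite size_rcons size_map. Qed.

Lemma avoids_append v w : avoids (append v w) = avoids w && active w v.
Proof.
rewrite /avoids quadwise_rcons quadwise_map triplewise_map; congr andb.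
  by apply: eq_quadwise => a b c d; rewrite /good4 !ltn_bump2.
apply: eq_triplewise => a b c.
rewrite /good4 !ltn_bump2 !(bump_lt_lo _ (leqnn v)).
by rewrite !(leq_bump_hi _ (leqnn v)); lia.
Qed.

Lemma standard_append v w : v <= size w -> standard w -> standard (append v w).
Proof.
move=> vn; rewrite /standard size_append => wP.
rewrite perm_sym; apply: uniq_perm; first exact: iota_uniq.
  rewrite rcons_uniq map_inj_uniq ?(perm_uniq wP) ?iota_uniq ?andbT.
    by apply/mapP => -[a _]; rewrite /bump; case: (leqP v a); lia.
  exact: can_inj (bumpK v).
move=> x; rewrite mem_iota mem_rcons inE add0n.
apply/idP/predU1P => [xn | [-> | /mapP[a]]]; first last.
- by rewrite (perm_mem wP) mem_iota /bump => h ->; lia.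
- by lia.
case: (x =P v) => [|xv]; first by left.
right; apply/mapP; exists (unbump v x); last by rewrite unbumpK // inE; apply/eqP.
rewrite (perm_mem wP) mem_iota /unbump.
by move: xv; lia.
Qed.

Section Gaps.
Variables (w : seq nat) (v : nat).
Hypotheses (wP : standard w) (vn : v <= size w).

Lemma mem_standard a : (a \in w) = (a < size w).
Proof. by rewrite (perm_mem wP) mem_iota. Qed.

Lemma active_lo g : g <= v -> active (append v w) g = active w g && lows_dec w g.
Proof.
move=> gv; rewrite /active triplewise_rcons triplewise_map pairwise_map.
congr andb.
  apply: eq_triplewise => a b c.
  by rewrite !ltn_bump2 !(bump_lt_lo _ gv) !(leq_bump_lo _ gv).
apply: eq_pairwise_seq => a b /=.
by rewrite !ltn_bump2 !(bump_lt_lo _ gv) !(leq_bump_lo _ gv) /bump; lia.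
Qed.

Lemma active_hi g : v <= g ->
  active (append v w) g.+1 = [&& active w g, highs_dec w g & lows_first_lt w g v].
Proof.
move=> gv; rewrite /active triplewise_rcons triplewise_map pairwise_map.
congr andb.
  apply: eq_triplewise => a b c.
  by rewrite !ltn_bump2 !(bump_lt_hi _ gv) !(leq_bump_hi _ gv).
rewrite -pairwise_relI; apply: eq_pairwise_seq => a b /=.
rewrite !ltn_bump2 !(bump_lt_hi _ gv) !(leq_bump_hi _ gv) /bump.
by case: (leqP v a); case: (leqP v b); lia.
Qed.

Lemma lows_dec_lo g : g <= v -> lows_dec (append v w) g = lows_dec w g.
Proof.
move=> gv; rewrite /lows_dec pairwise_rcons pairwise_map.
rewrite (_ : all _ _ = true) /=; last by apply/allP => a _ /=; lia.
by apply: eq_pairwise_seq => a b /=; rewrite ltn_bump2 bump_lt_lo.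
Qed.

Lemma lows_dec_hi g : v <= g ->
  lows_dec (append v w) g.+1 = (v == 0) && lows_dec w g.
Proof.
move=> gv; rewrite /lows_dec pairwise_rcons pairwise_map; congr andb.
  rewrite all_map; apply/allP/eqP => [h | -> a _ /=]; last by lia.
  (* For v = k + 1 the letter k of w is unchanged by [bump] and forms with the new letter an ascent
     below the gap. *)
  case: v vn gv h => // k kn kg /(_ k); rewrite mem_standard kn => /(_ isT) /=.
  by rewrite /bump; lia.
by apply: eq_pairwise_seq => a b /=; rewrite ltn_bump2 bump_lt_hi.
Qed.

Lemma highs_dec_lo g : g <= v ->
  highs_dec (append v w) g = (g == v) && highs_dec w g.
Proof.
move=> gv; rewrite /highs_dec pairwise_rcons pairwise_map; congr andb.
  rewrite all_map; apply/allP/eqP => [h | -> a _ /=]; last first.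
    by rewrite /bump; lia.
  apply/eqP; rewrite eqn_leq gv leqNgt; apply/negP => gv'.
  have /h /= : g \in w by rewrite mem_standard; lia.
  by rewrite /bump; lia.
by apply: eq_pairwise_seq => a b /=; rewrite ltn_bump2 leq_bump_lo.
Qed.

Lemma highs_dec_hi g : v <= g -> highs_dec (append v w) g.+1 = highs_dec w g.
Proof.
move=> gv; rewrite /highs_dec pairwise_rcons pairwise_map.
rewrite (_ : all _ _ = true) /=; last by apply/allP => a _ /=; lia.
by apply: eq_pairwise_seq => a b /=; rewrite ltn_bump2 leq_bump_hi.
Qed.

(** The new letter is above g and comes last, so every letter in [u, g) violates the test; if u < g,
    then u is itself such a letter. *)
Lemma lows_first_lt_lo g u : g <= v -> lows_first_lt (append v w) g u = (g <= u).
Proof.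
move=> gv; rewrite /lows_first_lt pairwise_rcons pairwise_map all_map.
case: (leqP g u) => gu.
  apply/andP; split; first by apply/allP => a _ /=; lia.
  by apply/pairwiseS => a b _ /=; lia.
apply/negbTE/nandP; left; apply/allPn; exists u; first by rewrite mem_standard; lia.
by rewrite /= /bump; lia.
Qed.

(** Raising a to a + 1 can affect the comparison with u only if a >= v, and the hypothesis already
    excludes every violating pair with such an a. *)
Lemma lows_first_lt_hi g u : v <= g -> lows_first_lt w g v ->
  lows_first_lt (append v w) g.+1 u = lows_first_lt w g u.
Proof.
move=> gv wv; rewrite /lows_first_lt pairwise_rcons pairwise_map.
rewrite (_ : all _ _ = true) /=; last by apply/allP => a _ /=; lia.
apply/pairwiseS/pairwiseS => h a b ab; have := h a b ab;
  have := pairwiseS _ _ wv a b ab; rewrite /= !(bump_lt_hi _ gv) !(leq_bump_hi _ gv);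
  by rewrite /bump; case: (leqP v a); lia.
Qed.

End Gaps.

(** * The list of active gaps *)

Fixpoint growths (r : nat) (w : seq nat) : nat :=
  if r is r'.+1 then
    \sum_(v <- iota 0 (size w).+1 | active w v) growths r' (append v w)
  else 1.

(** The four terms are the insertions into N, C, E and P gaps. The chosen E or P gap survives
    through its upper half, whence [s.+1]; the coercion of d to 0 or 1 in [d + e] is the E gap
    created by a marked C. *)
Fixpoint shape_growths (r : nat) (d : bool) (i e j : nat) : nat :=
  if r is r'.+1 then
    \sum_(t < i) shape_growths r' false t 0 j + shape_growths r' d i (d + e) j
    + \sum_(s < e) shape_growths r' false i s.+1 j
    + \sum_(s < j) shape_growths r' false i 0 s.+1
  else 1.

Lemma sum_sorted_below (s : seq nat) (F : nat -> nat) : sorted ltn s ->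
  \sum_(v <- s) F (size [seq u <- s | u < v]) = \sum_(t < size s) F t.
Proof.
elim: s F => [|x s IHs] F /=; first by rewrite big_nil big_ord0.
move=> xs; have /allP s_gt := order_path_min ltn_trans xs.
rewrite big_cons ltnn big_ord_recl; congr addn.
  rewrite (_ : filter _ _ = [::]) //; apply/eqP; rewrite -size_eq0 size_filter.
  by rewrite -leqn0 leqNgt -has_count; apply/hasPn => u /s_gt /=; lia.
rewrite -(IHs (F \o succn)) ?(path_sorted xs) //.
by apply: eq_big_seq => v /s_gt /= ->.
Qed.

Lemma sum_sorted_above (s : seq nat) (F : nat -> nat) : sorted ltn s ->
  \sum_(v <- s) F (size [seq u <- s | v <= u]) = \sum_(t < size s) F t.+1.
Proof.
elim: s => [|x s IHs] /=; first by rewrite big_nil big_ord0.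
move=> xs; have /allP s_gt := order_path_min ltn_trans xs.
rewrite big_cons leqnn big_ord_recr addnC; congr addn.
  rewrite -IHs ?(path_sorted xs) //.
  by apply: eq_big_seq => v /s_gt /= xv; rewrite [v <= x]leqNgt xv.
by rewrite /= (_ : filter _ _ = s) //; apply/all_filterP/allP => u /s_gt /=; lia.
Qed.

(* The list N^i C E^e P^j: the gap [th] is C, and [d] tells whether it is
   marked. *)
Record shape (w : seq nat) (d : bool) (Ns : seq nat) (th : nat)
    (Es Ps : seq nat) : Prop := Shape {
  shape_std : standard w;
  shape_sorted : [/\ sorted ltn Ns, sorted ltn Es & sorted ltn Ps];
  shape_Ns_lt : {in Ns, forall g, g < th};
  shape_Es_gt : {in Es, forall g, th < g};
  shape_Ps_gt : {in Ps, forall g, th < g};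
  shape_Es_Ps : {in Es & Ps, forall g h, g < h};
  shape_act : forall g, (g <= size w) && active w g =
    [|| g \in Ns, g == th, g \in Es | g \in Ps];
  shape_Ns : {in Ns, forall g, lows_dec w g /\ ~~ highs_dec w g};
  shape_th : [/\ lows_dec w th, highs_dec w th = d &
    d -> 0 < th /\ forall u, lows_first_lt w th u = (th <= u)];
  shape_Es : {in Es, forall g, [/\ ~~ lows_dec w g, highs_dec w g &
    forall u, lows_first_lt w g u = (th <= u)]};
  shape_Ps : {in Ps, forall g, [/\ ~~ lows_dec w g, highs_dec w g &
    forall u, lows_first_lt w g u]} }.

Lemma mem_mapS (s : seq nat) g : (g.+1 \in map succn s) = (g \in s).
Proof. exact: mem_map succn_inj _ _. Qed.

Lemma mem_mapS_above (s : seq nat) v g : g <= v ->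
  (g \in map succn [seq u <- s | v <= u]) = false.
Proof. by move=> gv; apply/mapP => -[u]; rewrite mem_filter; lia. Qed.

Lemma sorted_mapS (s : seq nat) : sorted ltn s -> sorted ltn (map succn s).
Proof. by rewrite sorted_map. Qed.

(** * Insertion into each kind of gap *)

Section Transitions.
Variables (w : seq nat) (d : bool) (Ns : seq nat) (th : nat) (Es Ps : seq nat).
Hypothesis shw : shape w d Ns th Es Ps.

(** Gaps up to v survive by [lows_dec], and the lower half of v is the new C, unmarked because
    [highs_dec] fails there. Above v, the N gaps and an unmarked C fail [highs_dec], while a marked
    C and the E gaps fail [lows_first_lt] since v < th. Only the P gaps pass both tests. *)
Lemma shape_append_low v : v \in Ns ->
  shape (append v w) false [seq u <- Ns | u < v] v [::] (map succn Ps).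
Proof.
case: shw => wP [sN sE sP] ltN gtE gtP EP actE kN kT kE kP vN.
have vt := ltN _ vN.
have /andP[vn actv] : (v <= size w) && active w v by rewrite actE vN.
have [ldv hdv] := kN _ vN.
split=> //.
- exact: standard_append.
- by split=> //; [apply: sorted_filter => //; exact: ltn_trans | exact: sorted_mapS].
- by move=> g; rewrite mem_filter => /andP[].
- by move=> g /mapP[u /gtP tu ->]; rewrite ltnS ltnW // (ltn_trans vt).
- move=> g; rewrite size_append; case: (leqP g v) => gv.
    rewrite in_nil active_lo // leqW ?(leq_trans gv) // mem_filter.
    rewrite (_ : (g \in map _ _) = false) ?orbF; last first.
      apply/mapP => -[u /gtP tu gu]; move: gv.
      by rewrite gu ltnNge ltnW ?(ltn_trans vt).
    case: (ltngtP g v) gv => // [gv _ | -> _]; last by rewrite actv ldv.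
    rewrite orbF /=; apply/andP/idP => [[ag ldg] | gN].
      have : (g <= size w) && active w g by rewrite ag (leq_trans (ltnW gv)).
      have gt := ltn_trans gv vt.
      rewrite actE => /or4P[// | /eqP | /gtE | /gtP]; by clear -gt; lia.
    have : (g <= size w) && active w g by rewrite actE gN.
    by case/andP=> _ ->; have [] := kN _ gN.
  case: g gv => // g gv; rewrite active_hi // ltnS andbA actE mem_mapS in_nil.
  rewrite mem_filter (gtn_eqF gv) (ltnNge g.+1) (ltnW gv) /=.
  apply/andP/idP => [[/or4P[gN | /eqP-> | gE | gP] /andP[hg lg]] | gP] //.
  + by have [_] := kN _ gN; rewrite hg.
  + by case: kT => _ hd; rewrite -hd hg => -[] // _ lE; move: lg; rewrite lE leqNgt vt.
  + by have [_ _ lE] := kE _ gE; move: lg; rewrite lE leqNgt vt.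
  + by have [_ -> ->] := kP _ gP; rewrite gP !orbT.
- move=> g; rewrite mem_filter => /andP[gv gN].
  rewrite lows_dec_lo ?highs_dec_lo ?(ltnW gv) //.
  by have [-> _] := kN _ gN; rewrite ltn_eqF.
- split=> //; first by rewrite lows_dec_lo.
  by rewrite highs_dec_lo // (negbTE hdv) andbF.
- move=> g /mapP[u uP ->]; have := gtP _ uP => tu.
  have vu : v <= u by exact: ltnW (ltn_trans vt tu).
  have [ldu hdu lu] := kP _ uP.
  rewrite lows_dec_hi // (negbTE ldu) andbF highs_dec_hi // hdu.
  by split=> // x; rewrite lows_first_lt_hi.
Qed.

(** The N gaps and C lie at or below v and survive by [lows_dec], which kills the E and P gaps below
    v and the lower half of a chosen one. The E and P gaps from v on survive as upper halves, as
    [lows_first_lt] holds for v >= th. C keeps its mark only if v = th, because otherwise th and v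
    form an ascent above it. *)
Lemma shape_append_high v : th <= v -> v <= size w -> active w v ->
  shape (append v w) (d && (v == th)) Ns th
    ((if d && (v == th) then [:: th.+1] else [::])
       ++ map succn [seq u <- Es | v <= u])
    (map succn [seq u <- Ps | v <= u]).
Proof.
case: shw => wP [sN sE sP] ltN gtE gtP EP actE kN [ldT hdT kT] kE kP tv vn actv.
have kE1 : {in map succn [seq u <- Es | v <= u], forall g,
    [/\ ~~ lows_dec (append v w) g, highs_dec (append v w) g &
        forall u, lows_first_lt (append v w) g u = (th <= u)]}.
  move=> g /mapP[u]; rewrite mem_filter => /andP[vu uE] ->.
  have [ldu hdu lu] := kE _ uE.
  rewrite lows_dec_hi // (negbTE ldu) andbF highs_dec_hi // hdu.
  by split=> // x; rewrite lows_first_lt_hi ?lu.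
split=> //.
- exact: standard_append.
- have sfE : sorted ltn (map succn [seq u <- Es | v <= u]).
    by apply: sorted_mapS; apply: sorted_filter => //; exact: ltn_trans.
  split=> //; last by apply: sorted_mapS; apply: sorted_filter => //; exact: ltn_trans.
  case: ifP => //= _; rewrite (path_sortedE ltn_trans) sfE andbT.
  apply/allP => g /mapP[u]; rewrite mem_filter => /andP[_ /gtE] + ->.
  by [].
- move=> g; rewrite mem_cat => /orP[|/mapP[u]].
    by case: ifP; rewrite // inE => _ /eqP->.
  by rewrite mem_filter => /andP[_ /gtE] + ->; lia.
- by move=> g /mapP[u]; rewrite mem_filter => /andP[_ /gtP] + ->; lia.
- move=> g h + /mapP[u]; rewrite mem_filter mem_cat => + /andP[_ uP] ->.
  case/orP=> [|/mapP[x]]; first by case: ifP; rewrite // inE => _ /eqP->; exact: gtP.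
  by rewrite mem_filter => /andP[_ xE] ->; have := EP _ _ xE uP.
- move=> g; rewrite size_append mem_cat; case: (leqP g v) => gv.
    rewrite active_lo // leqW ?(leq_trans gv) // !mem_mapS_above // !orbF.
    rewrite (_ : (g \in if _ then _ else _) = false) ?orbF; last first.
      by case: ifP; rewrite // inE => /andP[_ /eqP <-]; lia.
    have -> : true && (active w g && lows_dec w g) =
        ((g <= size w) && active w g) && lows_dec w g.
      by rewrite (leq_trans gv).
    rewrite actE; apply/andP/orP => [[/or4P[-> | -> | gE | gP] ldg] | [gN | /eqP->]].
    + by left.
    + by right.
    + by have [] := kE _ gE; rewrite ldg.
    + by have [] := kP _ gP; rewrite ldg.
    + by rewrite gN; have [->] := kN _ gN.
    + by rewrite eqxx orbT.
  case: g gv => // g gv; rewrite active_hi // ltnS andbA actE !mem_mapS.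
  rewrite !mem_filter -[v <= g]/(v < g.+1) gv !andTb.
  rewrite (_ : (g.+1 \in Ns) = false); last by apply/negP => /ltN; lia.
  rewrite (_ : (g \in Ns) = false); last by apply/negP => /ltN; lia.
  rewrite (_ : (g.+1 == th) = false); last by lia.
  (* Here g = th forces v = th, and the gap in question is the upper half of C: it is active exactly
     when C was marked, and it is then the new E gap. *)
  rewrite /=; case: (eqVneq g th) gv => [-> | gt] gv.
    have -> : v = th by lia.
    rewrite eqxx andbT hdT; case: d kT => [/(_ isT)[_ ->]|_].
      by rewrite leqnn inE eqxx.
    rewrite (_ : (th \in Es) = false); last by apply/negP => /gtE; lia.
    by rewrite (_ : (th \in Ps) = false) //; apply/negP => /gtP; lia.
  rewrite (_ : (g.+1 \in if _ then _ else _) = false); last first.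
    by case: ifP => //; rewrite inE eqSS (negbTE gt).
  rewrite /=; case gE : (g \in Es) => /=; first by have [_ -> ->] := kE _ gE.
  by case gP : (g \in Ps) => //=; have [_ -> ->] := kP _ gP.
- move=> g gN; have gt := ltN _ gN; have [ldg hdg] := kN _ gN.
  have gv : g <= v by exact: ltnW (leq_trans gt tv).
  by rewrite lows_dec_lo // highs_dec_lo // (negbTE hdg) andbF.
- split; first by rewrite lows_dec_lo.
    by rewrite highs_dec_lo // hdT andbC eq_sym.
  case/andP=> /kT [t0 _] /eqP vt; split=> // u.
  by rewrite lows_first_lt_lo.
- move=> g; rewrite mem_cat => /orP[|/kE1 //].
  case: ifP => //; rewrite inE => /andP[dT /eqP vt] /eqP->.
  have [t0 kTl] := kT dT.
  have vt' : v <= th by rewrite vt.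
  rewrite lows_dec_hi // highs_dec_hi // hdT dT; split=> //; first by lia.
  by move=> u; rewrite lows_first_lt_hi // kTl vt.
- move=> g /mapP[u]; rewrite mem_filter => /andP[vu uP] ->.
  have [ldu hdu lu] := kP _ uP.
  rewrite lows_dec_hi // (negbTE ldu) andbF highs_dec_hi // hdu.
  by split=> // x; rewrite lows_first_lt_hi ?lu.
Qed.

Lemma perm_active_gaps :
  perm_eq [seq v <- iota 0 (size w).+1 | active w v] (Ns ++ th :: Es ++ Ps).
Proof.
case: shw => wP [sN sE sP] ltN gtE gtP EP actE _ _ _ _.
have uniqS := sorted_uniq ltn_trans ltnn.
apply: uniq_perm; first by rewrite filter_uniq ?iota_uniq.
  rewrite cat_uniq (uniqS _ sN) /= cat_uniq (uniqS _ sE) (uniqS _ sP) mem_cat /=.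
  rewrite !andbT !negb_or -!andbA. apply/and5P; split.
  + by apply/negP => /ltN; lia.
  + apply/hasPn => x; rewrite mem_cat => xEP; apply/negP => /ltN.
    by case/orP: xEP => [/gtE|/gtP]; lia.
  + by apply/negP => /gtE; lia.
  + by apply/negP => /gtP; lia.
  + by apply/hasPn => x xP; apply/negP => xE; have := EP _ _ xE xP; lia.
by move=> g; rewrite mem_filter mem_iota !mem_cat inE mem_cat -actE andbC.
Qed.

End Transitions.

Lemma growths_shape r w d Ns th Es Ps : shape w d Ns th Es Ps ->
  growths r w = shape_growths r d (size Ns) (size Es) (size Ps).
Proof.
elim: r w d Ns th Es Ps => // r IHr w d Ns th Es Ps shw.
rewrite [LHS]/= -big_filter (perm_big _ (perm_active_gaps shw)).
rewrite big_cat big_cons big_cat /= -!addnA.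
have [wP [sN sE sP] ltN gtE gtP EP actE _ _ _ _] := shw.
(* One formula serves C, E and P: [d && (v == th)] is both the new mark and the number of E gaps
   created. *)
have IHhigh v : th <= v -> [|| v == th, v \in Es | v \in Ps] ->
    growths r (append v w) = shape_growths r (d && (v == th)) (size Ns)
      ((d && (v == th)) + size [seq u <- Es | v <= u])
      (size [seq u <- Ps | v <= u]).
  move=> tv vA.
  have /andP[vn actv] : (v <= size w) && active w v by rewrite actE vA orbT.
  rewrite (IHr _ _ _ _ _ _ (shape_append_high shw tv vn actv)) size_cat !size_map.
  by case: ifP.
congr (_ + (_ + (_ + _))).
- rewrite -(sum_sorted_below (fun t => shape_growths r false t 0 (size Ps))) //.
  apply: eq_big_seq => v vN.
  by rewrite (IHr _ _ _ _ _ _ (shape_append_low shw vN)) size_map.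
- rewrite IHhigh ?eqxx // andbT.
  rewrite (_ : [seq u <- Es | th <= u] = Es).
    rewrite (_ : [seq u <- Ps | th <= u] = Ps) //.
    by apply/all_filterP/allP => u /gtP /ltnW.
  by apply/all_filterP/allP => u /gtE /ltnW.
- rewrite -(sum_sorted_above (fun s => shape_growths r false (size Ns) s (size Ps))) //.
  apply: eq_big_seq => v vE; have tv := gtE _ vE.
  rewrite IHhigh ?vE ?orbT ?(ltnW tv) // gtn_eqF // andbF add0n.
  rewrite (_ : [seq u <- Ps | v <= u] = Ps) //.
  by apply/all_filterP/allP => u uP; exact: ltnW (EP _ _ vE uP).
- rewrite -(sum_sorted_above (fun s => shape_growths r false (size Ns) 0 s)) //.
  apply: eq_big_seq => v vP; have tv := gtP _ vP.
  rewrite IHhigh ?vP ?orbT ?(ltnW tv) // gtn_eqF // andbF add0n.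
  rewrite (_ : [seq u <- Es | v <= u] = [::]) //.
  apply/eqP; rewrite -size_eq0 size_filter -leqn0 leqNgt -has_count.
  by apply/hasPn => u uE /=; rewrite -ltnNge (EP _ _ uE vP).
Qed.

(** This is what is needed of a decreasing word: every violation of one of the four tests contains
    an ascent, so all of them hold at all gaps. *)
Definition decreasing_shape (w : seq nat) : Prop :=
  standard w /\ forall g, g <= size w ->
    [/\ active w g, lows_dec w g, highs_dec w g & forall u, lows_first_lt w g u].

Lemma decreasing_shape_append0 w : decreasing_shape w -> decreasing_shape (append 0 w).
Proof.
case=> wP kw; split; first exact: standard_append.
case=> [|g]; rewrite size_append => gn.
  have [a l h f] := kw 0 isT.
  rewrite active_lo // lows_dec_lo // highs_dec_lo // a l h.
  by split=> // u; rewrite lows_first_lt_lo.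
have [a l h f] := kw g gn.
rewrite active_hi // lows_dec_hi // highs_dec_hi // a l h f.
by split=> // u; rewrite lows_first_lt_hi.
Qed.

(** The letter v + 1 creates the first ascents. All lower gaps pass [lows_dec] and become N; the
    lower half of gap v + 1 is C, marked because no ascent lies above it; the upper half and all
    higher gaps have an ascent below them and become P. *)
Lemma decreasing_shape_appendS w v : decreasing_shape w -> v < size w ->
  shape (append v.+1 w) true (iota 0 v.+1) v.+1 [::] (iota v.+2 (size w - v)).
Proof.
case=> wP kw vn; split=> //.
- exact: standard_append.
- by split=> //; exact: iota_ltn_sorted.
- by move=> g; rewrite mem_iota.
- by move=> g; rewrite mem_iota => /andP[].
- move=> g; rewrite size_append !mem_iota in_nil /=.
  case: (leqP g v.+1) => gv.
    have [a l _ _] : _ := kw g (leq_trans gv vn).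
    by rewrite active_lo // a l; lia.
  case: g gv => // g gv; rewrite active_hi //.
  case: (leqP g (size w)) => gn; last by lia.
  by have [-> _ -> ->] := kw g gn; lia.
- move=> g; rewrite mem_iota => /andP[_ gv].
  have [_ l _ _] := kw g (leq_trans (ltnW gv) vn).
  rewrite lows_dec_lo ?highs_dec_lo ?(ltnW gv) // l.
  by split=> //; lia.
- have [_ l h _] := kw v.+1 vn.
  rewrite lows_dec_lo // highs_dec_lo // l h eqxx; split=> // _.
  by split=> // u; rewrite lows_first_lt_lo.
- case=> [|g]; rewrite mem_iota // => /andP[gv gn].
  have [|_ l h f] := kw g; first by lia.
  rewrite lows_dec_hi // highs_dec_hi // h.
  by split=> // u; rewrite lows_first_lt_hi.
Qed.

Lemma growths_decreasing r w : decreasing_shape w ->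
  growths r.+1 w = growths r (append 0 w)
    + \sum_(v < size w) shape_growths r true v.+1 0 (size w - v).
Proof.
move=> Dw; rewrite [LHS]/= big_cons.
have [wP kw] := Dw; have [-> _ _ _] := kw 0 isT.
congr addn; rewrite -[iota 1 _]/(iota (1 + 0) _) iotaDl big_map.
rewrite -[in iota 0 _](subn0 (size w)) -/(index_iota 0 (size w)) big_mkord.
apply: eq_big => [v | v _]; first by have [] := kw v.+1 (ltn_ord v).
rewrite (growths_shape r (decreasing_shape_appendS Dw (ltn_ord v))).
by rewrite !size_iota.
Qed.

(** * Permutations as words *)

Fixpoint avoiding_words (n : nat) : seq (seq nat) :=
  if n is k.+1 then
    [seq append v w | w <- avoiding_words k,
                      v <- [seq v <- iota 0 k.+1 | active w v]]
  else [:: [::]].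

Lemma append_inj v w v' w' : append v w = append v' w' -> w = w' /\ v = v'.
Proof.
by move=> /rcons_inj[ww vv]; move: ww; rewrite -vv => /(inj_map (can_inj (bumpK v))).
Qed.

Lemma standard_append_inv w n : standard w -> size w = n.+1 ->
  exists v u, [/\ v <= n, size u = n, standard u & w = append v u].
Proof.
case/lastP: w => // s v; rewrite /standard size_rcons => wP [sn].
have us : uniq (rcons s v) by rewrite (perm_uniq wP) iota_uniq.
move: us; rewrite rcons_uniq => /andP[vs us].
have w_le a : a \in rcons s v -> a <= n by rewrite (perm_mem wP) mem_iota sn.
have ss : map (bump v) (map (unbump v) s) = s.
  rewrite -map_comp -[RHS]map_id; apply/eq_in_map => a sa /=.
  by rewrite unbumpK // inE; apply: contraNneq vs => <-.
exists v, (map (unbump v) s); split; rewrite ?size_map //; last by rewrite /append ss.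
  by apply: w_le; rewrite mem_rcons mem_head.
have uu : uniq (map (unbump v) s) by apply: (@map_uniq _ _ (bump v)); rewrite ss.
rewrite sn; apply: uniq_perm => //; first exact: iota_uniq.
(* The n lowered letters are distinct, so it suffices that all of them are below n. *)
apply: (uniq_min_size uu _ _).2; last by rewrite size_iota size_map sn.
move=> b /mapP[a sa ->]; rewrite mem_iota add0n.
have anv : a != v by apply: contraNneq vs => <-.
have vn : v <= n by apply: w_le; rewrite mem_rcons mem_head.
have an : a <= n by apply: w_le; rewrite mem_rcons in_cons sa orbT.
by move: anv vn an; clear; rewrite /unbump; lia.
Qed.

Lemma mem_avoiding_words n w :
  (w \in avoiding_words n) = [&& size w == n, standard w & avoids w].
Proof.
elim: n w => [|n IHn] w; first by rewrite inE; case: w.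
apply/allpairsPdep/and3P => [[u [v [+ + ->]]] | [/eqP sw wP aw]].
  rewrite IHn mem_filter mem_iota size_append => /and3P[/eqP su uP au] /andP[a vn].
  by rewrite su eqxx avoids_append au a standard_append // su.
have [v [u [vn su uP uE]]] := standard_append_inv wP sw.
move: aw; rewrite uE avoids_append => /andP[au a].
exists u, v; split=> //; first by rewrite IHn su eqxx uP.
by rewrite mem_filter a mem_iota.
Qed.

Lemma uniq_avoiding_words n : uniq (avoiding_words n).
Proof.
elim: n => // n IHn; apply: allpairs_uniq_dep => //.
  by move=> w _; rewrite filter_uniq // iota_uniq.
by move=> [w v] [w' v'] _ _ /= /append_inj[-> ->].
Qed.

Lemma sum_growths_avoiding_words r n :
  \sum_(w <- avoiding_words n) growths r w = size (avoiding_words (n + r)).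
Proof.
elim: r n => [|r IHr] n; first by rewrite sum1_size addn0.
rewrite addnS -addSn -IHr [RHS]big_allpairs_dep.
apply: eq_big_seq => w; rewrite mem_avoiding_words => /and3P[/eqP sw _ _].
by rewrite [LHS]/= big_filter sw.
Qed.

Lemma size_avoiding_words n : size (avoiding_words n) = growths n [::].
Proof. by rewrite -(sum_growths_avoiding_words n 0) big_seq1. Qed.

(** * Pattern occurrences and the inverse permutation *)

Lemma subseq_enum_ord n (s : seq 'I_n) :
  subseq s (enum 'I_n) = sorted ltn (map val s).
Proof.
have e_sorted : sorted (relpre val ltn) (enum 'I_n).
  by rewrite -sorted_map val_enum_ord iota_ltn_sorted.
have tr : transitive (relpre (val : 'I_n -> nat) ltn).
  by move=> x y z; exact: ltn_trans.
rewrite sorted_map; apply/idP/idP => [sub | s_sorted].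
  exact: subseq_sorted sub e_sorted.
(* An increasing sequence is recovered from its set of members by filtering the increasing
   enumeration. *)
suff -> : s = filter (mem s) (enum 'I_n) by exact: filter_subseq.
apply: (irr_sorted_eq tr) => //; first by move=> x; exact: ltnn.
  exact: sorted_filter.
by move=> x; rewrite mem_filter mem_enum andbT.
Qed.

Lemma containsP n (pi : 'S_n) tau :
  reflect (exists2 t : seq 'I_n, sorted ltn (map val t) &
             order_iso [seq (pi i).+1 | i <- t] tau)
          (contains pi tau).
Proof.
apply: (iffP existsP) => [[m] | [t]].
  rewrite /one_line -map_mask => iso.
  by exists (mask m (enum 'I_n)); rewrite // -subseq_enum_ord mask_subseq.
rewrite -subseq_enum_ord => /subseqP[m sm ->] iso.
have sm' : size m == n by rewrite sm size_enum_ord.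
by exists (Tuple sm'); rewrite /one_line -map_mask.
Qed.


Lemma order_isoP (s t : seq nat) :
  reflect (size s = size t /\ {in gtn (size s) &, forall i j,
             (nth 0 s i < nth 0 s j) = (nth 0 t i < nth 0 t j)})
          (order_iso s t).
Proof.
apply: (iffP andP) => [[/eqP st /'forall_'forall_eqP iso] | [/eqP st iso]].
  by split=> // i j li lj; exact: (iso (Ordinal li) (Ordinal lj)).
by split=> //; apply/'forall_'forall_eqP => i j; apply: iso; apply: ltn_ord.
Qed.

(** Reading the letters in the order of the pattern values gives a chain of three inequalities,
    which decides all comparisons. The next two patterns are treated in the same way. *)
Lemma order_iso_1243 x y z t :
  order_iso [:: x; y; z; t] [:: 1; 2; 4; 3] = [&& x < y, y < t & t < z].
Proof.
apply/order_isoP/and3P => [[_ iso] | [xy yt tz]].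
  by rewrite (iso 0 1) // (iso 1 3) // (iso 3 2).
split=> // -[|[|[|[|//]]]] [|[|[|[|//]]]] _ _ /=; lia.
Qed.

Lemma order_iso_3142 x y z t :
  order_iso [:: x; y; z; t] [:: 3; 1; 4; 2] = [&& y < t, t < x & x < z].
Proof.
apply/order_isoP/and3P => [[_ iso] | [xy yt tz]].
  by rewrite (iso 1 3) // (iso 3 0) // (iso 0 2).
split=> // -[|[|[|[|//]]]] [|[|[|[|//]]]] _ _ /=; lia.
Qed.

Lemma order_iso_3412 x y z t :
  order_iso [:: x; y; z; t] [:: 3; 4; 1; 2] = [&& z < t, t < x & x < y].
Proof.
apply/order_isoP/and3P => [[_ iso] | [xy yt tz]].
  by rewrite (iso 2 3) // (iso 3 0) // (iso 0 1).
split=> // -[|[|[|[|//]]]] [|[|[|[|//]]]] _ _ /=; lia.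
Qed.

Lemma contains4P n (pi : 'S_n) (a b c d : nat) :
  reflect (exists i j k l : 'I_n, [/\ i < j, j < k, k < l &
             order_iso [:: (pi i).+1; (pi j).+1; (pi k).+1; (pi l).+1]
               [:: a; b; c; d]])
          (contains pi [:: a; b; c; d]).
Proof.
apply: (iffP (containsP _ _)) => [[t t_sorted iso] | [i [j [k [l [ij jk kl iso]]]]]].
  have [+ _] := order_isoP _ _ iso; rewrite size_map.
  case: t t_sorted iso => [|i [|j [|k [|l [|]]]]] //= /and4P[ij jk kl _] iso _.
  by exists i, j, k, l.
by exists [:: i; j; k; l]; rewrite //= ij jk kl.
Qed.

Definition inverse_word n (pi : 'S_n) : seq nat :=
  [seq val (pi^-1%g i) | i <- enum 'I_n].

(** Inversion exchanges positions and values: an occurrence of a pattern in pi, read by increasing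
    value, is an occurrence of the inverse pattern in the inverse word. *)
Lemma avoids_inverse_word n (pi : 'S_n) :
  avoids (inverse_word pi) =
  (pi \in avoiders n [:: [:: 1; 2; 4; 3]; [:: 3; 1; 4; 2]; [:: 3; 4; 1; 2]]).
Proof.
rewrite inE /= andbT /avoids quadwise_map.
apply/quadwiseS/and3P => [good | [av1 av2 av3] x y z t].
  have {}good (i j k l : 'I_n) : i < j -> j < k -> k < l ->
      good4 (pi^-1%g i) (pi^-1%g j) (pi^-1%g k) (pi^-1%g l).
    by move=> ij jk kl; apply: good; rewrite subseq_enum_ord /= ij jk kl.
  split; apply/contains4P => -[i [j [k [l [ij jk kl]]]]].
  - rewrite order_iso_1243 !ltnS => /and3P[h1 h2 h3].
    by have := good _ _ _ _ h1 h2 h3; rewrite !permK /good4 ij jk kl.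
  - rewrite order_iso_3142 !ltnS => /and3P[h1 h2 h3].
    by have := good _ _ _ _ h1 h2 h3; rewrite !permK /good4 ij jk kl !orbT.
  - rewrite order_iso_3412 !ltnS => /and3P[h1 h2 h3].
    by have := good _ _ _ _ h1 h2 h3; rewrite !permK /good4 ij jk kl !orbT.
rewrite subseq_enum_ord /= => /and4P[xy yz zt _].
apply/or3P => -[] /andP[/andP[h1 h2] h3].
(* The positions of the occurrence in pi are the four letters of the inverse word in increasing
   order; unification with the inequalities finds them. *)
- by case/contains4P: av1; do 4!eexists; split;
    [exact: h1 | exact: h2 | exact: h3 |];
    rewrite order_iso_1243 !permKV !ltnS xy yz.
- by case/contains4P: av2; do 4!eexists; split;
    [exact: h1 | exact: h2 | exact: h3 |];
    rewrite order_iso_3142 !permKV !ltnS xy yz.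
- by case/contains4P: av3; do 4!eexists; split;
    [exact: h1 | exact: h2 | exact: h3 |];
    rewrite order_iso_3412 !permKV !ltnS xy yz.
Qed.

Lemma size_inverse_word n (pi : 'S_n) : size (inverse_word pi) = n.
Proof. by rewrite size_map size_enum_ord. Qed.

Lemma inverse_word_inj n : injective (@inverse_word n).
Proof.
move=> pi rho /eq_in_map eq_pr; apply: invg_inj; apply/permP => i.
by apply/val_inj/eq_pr; rewrite mem_enum.
Qed.

Lemma inverse_word_standard n (pi : 'S_n) : standard (inverse_word pi).
Proof.
rewrite /standard size_inverse_word; apply: uniq_perm; last 1 first.
- move=> a; rewrite mem_iota add0n; apply/mapP/idP => [[i _ ->] | an].
    exact: ltn_ord.
  by exists (pi (Ordinal an)); rewrite ?mem_enum // permK.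
- by rewrite map_inj_uniq ?enum_uniq // => i j /val_inj /perm_inj.
- exact: iota_uniq.
Qed.

Lemma inverse_word_surj n w : size w = n -> standard w ->
  exists pi : 'S_n, w = inverse_word pi.
Proof.
move=> sw wP.
have w_lt (i : 'I_n) : nth 0 w i < n.
  by rewrite -[ltnRHS]sw -(mem_standard wP) mem_nth // sw.
have w_uniq : uniq w by rewrite (perm_uniq wP) iota_uniq.
have f_inj : injective (fun i : 'I_n => Ordinal (w_lt i)).
  move=> i j [/eqP]; rewrite nth_uniq ?sw // => /eqP; exact: val_inj.
exists (perm f_inj)^-1%g; apply: (@eq_from_nth _ 0).
  by rewrite size_inverse_word.
move=> i; rewrite sw => lt_i; rewrite (nth_map (Ordinal lt_i)) ?size_enum_ord //.
by rewrite invgK permE /= nth_enum_ord.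
Qed.

Lemma card_avoiders n :
  #|avoiders n [:: [:: 1; 2; 4; 3]; [:: 3; 1; 4; 2]; [:: 3; 4; 1; 2]]| =
  growths n [::].
Proof.
rewrite -size_avoiding_words cardE -(size_map (@inverse_word n)).
apply/perm_size/uniq_perm.
- by rewrite map_inj_uniq ?enum_uniq //; exact: inverse_word_inj.
- exact: uniq_avoiding_words.
move=> w; rewrite mem_avoiding_words; apply/mapP/and3P => [[pi] | [/eqP sw wP aw]].
  rewrite mem_enum -avoids_inverse_word => api ->.
  by rewrite size_inverse_word inverse_word_standard.
have [pi wE] := inverse_word_surj sw wP.
by exists pi; rewrite // mem_enum -avoids_inverse_word -wE.
Qed.

(** * Generating functions *)

Local Open Scope ring_scope.

Local Notation X := (@fpsX int).

Lemma fcoefD (f g : fps int) n : fcoef (f + g) n = fcoef f n + fcoef g n.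
Proof. by []. Qed.

Lemma fcoef_sum (I : Type) (r : seq I) (F : I -> fps int) n :
  fcoef (\sum_(i <- r) F i) n = \sum_(i <- r) fcoef (F i) n.
Proof. by elim/big_rec2: _ => // i _ f _ <-. Qed.

Lemma fcoef_xM0 (f : fps int) : fcoef (X * f) 0 = 0.
Proof. by rewrite /= big_ord1 mul0r. Qed.

Lemma fcoef_xMS (f : fps int) n : fcoef (X * f) n.+1 = fcoef f n.
Proof.
rewrite /= big_ord_recl mul0r add0r big_ord_recl mul1r subSS subn0.
by rewrite big1 ?addr0 // => i _; rewrite mul0r.
Qed.

Lemma unit_1DxM (f : fps int) : 1 + X * f \is a GRing.unit.
Proof. by rewrite unfold_in /= /fps_unit fcoefD fcoef_xM0 addr0 unitr1. Qed.

Definition gf (c : nat -> nat) : fps int := Fps (fun n => (c n)%:R).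

Lemma gf_cons (c c' : nat -> nat) : c 0%N = 1%N ->
  (forall n, c n.+1 = c' n) -> gf c = 1 + X * gf c'.
Proof.
move=> c0 cS; apply: fpsP => -[|n]; rewrite fcoefD ?fcoef_xM0 ?fcoef_xMS /=.
  by rewrite c0 addr0.
by rewrite cS add0r.
Qed.

Lemma gfD (c c' : nat -> nat) : gf (fun n => (c n + c' n)%N) = gf c + gf c'.
Proof. by apply: fpsP => n; rewrite fcoefD /= natrD. Qed.

Lemma gf_sum m (c : nat -> nat -> nat) :
  gf (fun n => (\sum_(i < m) c i n)%N) = \sum_(i < m) gf (c i).
Proof. by apply: fpsP => n; rewrite fcoef_sum /= natr_sum. Qed.

(* The series sum_k x^k f(n + k). *)
Definition xtail (f : nat -> fps int) (n : nat) : fps int :=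
  Fps (fun m => \sum_(k < m.+1) fcoef (f (n + k)%N) (m - k)).

(** The factor X makes coefficient m of Q n depend only on f and on coefficient m - 1 of Q (n + 1).
    Identities between tails are proved below by checking this recurrence. *)
Lemma xtail_unique (f Q : nat -> fps int) :
  (forall n, Q n = f n + X * Q n.+1) -> Q =1 xtail f.
Proof.
move=> QE n; apply: fpsP => m; elim: m n => [|m IHm] n; rewrite QE fcoefD.
  by rewrite fcoef_xM0 addr0 /= big_ord1 addn0.
rewrite fcoef_xMS IHm [RHS]big_ord_recl addn0 subn0; congr (_ + _).
by apply: eq_bigr => i _; rewrite /= /bump add1n subSS addnS.
Qed.

Lemma xtailE (f : nat -> fps int) n : xtail f n = f n + X * xtail f n.+1.
Proof.
apply: fpsP => -[|m]; rewrite fcoefD ?fcoef_xM0 ?fcoef_xMS.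
  by rewrite addr0 /= big_ord1 addn0.
rewrite [LHS]big_ord_recl addn0 subn0; congr (_ + _).
by apply: eq_bigr => i _; rewrite /= /bump add1n subSS addnS.
Qed.

Lemma eq_xtail (f g : nat -> fps int) n : f =1 g -> xtail f n = xtail g n.
Proof.
by move=> fg; apply: (xtail_unique (Q := xtail f)) => k; rewrite xtailE fg.
Qed.

Lemma xtailD (f g : nat -> fps int) n :
  xtail (fun k => f k + g k) n = xtail f n + xtail g n.
Proof.
apply/esym; apply: (xtail_unique (Q := fun n => xtail f n + xtail g n)) => k.
by rewrite (xtailE f) (xtailE g); ring.
Qed.

Lemma xtailM (c : fps int) (f : nat -> fps int) n :
  xtail (fun k => c * f k) n = c * xtail f n.
Proof.
apply/esym; apply: (xtail_unique (Q := fun n => c * xtail f n)) => k.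
by rewrite (xtailE f); ring.
Qed.

Lemma xtail_sum m (f : nat -> nat -> fps int) n :
  xtail (fun k => \sum_(i < m) f i k) n = \sum_(i < m) xtail (f i) n.
Proof.
apply/esym; apply: (xtail_unique (Q := fun n => \sum_(i < m) xtail (f i) n)) => k.
by rewrite mulr_sumr -big_split; apply: eq_bigr => i _; exact: xtailE.
Qed.

Lemma xtail1 : (1 - X) * xtail (fun=> 1) 0 = 1.
Proof.
have E : xtail (fun=> 1) 0 = 1 + X * xtail (fun=> 1) 0 by exact: xtailE.
by rewrite mulrBl mul1r {1}E addrK.
Qed.

Lemma xtail_partial_sums (f : nat -> fps int) :
  (1 - X) * xtail (fun k => \sum_(t < k.+1) f t) 0 = xtail f 0.
Proof.
pose h k := \sum_(t < k.+1) f t.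
(* Summation by parts turns (1 - X) times the tail of h into h n plus the terms x^k f(n + k) with k
   >= 1; removing the terms of f before n leaves the tail of f. *)
pose Q n := (1 - X) * xtail h n - \sum_(t < n) f t.
have -> : (1 - X) * xtail h 0 = Q 0%N by rewrite /Q big_ord0 subr0.
apply: xtail_unique => n; rewrite /Q (xtailE h n) /h big_ord_recr /=.
by ring.
Qed.

Lemma xtail_shift (f : nat -> fps int) n :
  xtail (fun k => f k.+1) n = xtail f n.+1.
Proof.
apply/esym; apply: (xtail_unique (Q := fun n => xtail f n.+1)) => k.
exact: xtailE.
Qed.

Lemma xtail_diagonal (g : nat -> nat -> fps int) :
  xtail (fun n => \sum_(v < n.+1) g v (n - v)%N) 0 =
  xtail (fun v => xtail (g v) 0) 0.
Proof.
(* Q k is the double sum over the rows v >= k, divided by x^k; splitting off row k gives the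
   recurrence. *)
pose Q k := xtail (fun n => \sum_(v < n.+1) g (k + v)%N (n - v)%N) 0.
rewrite -[LHS]/(Q 0%N); apply: xtail_unique => k.
(* The remaining rows; at n = 0 the sum is empty, so the value of [n.-1] there is harmless. *)
pose d n := \sum_(v < n) g (k.+1 + v)%N (n.-1 - v)%N.
have -> : Q k = xtail (fun n => g k n + d n) 0.
  apply: eq_xtail => n; rewrite big_ord_recl addn0 subn0; congr (_ + _).
  apply: eq_bigr => i _; rewrite /= /bump add1n addSnnS; congr (g _ _).
  by case: n i => [|n] i; rewrite ?subSS //; case: i.
rewrite xtailD; congr (_ + _).
by rewrite xtailE -xtail_shift {1}/d big_ord0 add0r.
Qed.

(** * Functional equations and their solution *)

Definition Mgf i e j := gf (fun r => shape_growths r false i e j).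
Definition Dgf i e j := gf (fun r => shape_growths r true i e j).

Lemma MgfE i e j : Mgf i e j = 1 + X * (\sum_(t < i) Mgf t 0 j + Mgf i e j
  + \sum_(s < e) Mgf i s.+1 j + \sum_(s < j) Mgf i 0 s.+1).
Proof.
rewrite {1}/Mgf (gf_cons (c' := fun r =>
  (\sum_(t < i) shape_growths r false t 0 j + shape_growths r false i e j
   + \sum_(s < e) shape_growths r false i s.+1 j
   + \sum_(s < j) shape_growths r false i 0 s.+1)%N)) // !gfD.
by rewrite (gf_sum i (fun t r => shape_growths r false t 0 j))
  (gf_sum e (fun s r => shape_growths r false i s.+1 j))
  (gf_sum j (fun s r => shape_growths r false i 0 s.+1)).
Qed.

Lemma DgfE i e j : Dgf i e j = 1 + X * (\sum_(t < i) Mgf t 0 j + Dgf i e.+1 j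
  + \sum_(s < e) Mgf i s.+1 j + \sum_(s < j) Mgf i 0 s.+1).
Proof.
rewrite {1}/Dgf (gf_cons (c' := fun r =>
  (\sum_(t < i) shape_growths r false t 0 j + shape_growths r true i e.+1 j
   + \sum_(s < e) shape_growths r false i s.+1 j
   + \sum_(s < j) shape_growths r false i 0 s.+1)%N)) // !gfD.
by rewrite (gf_sum i (fun t r => shape_growths r false t 0 j))
  (gf_sum e (fun s r => shape_growths r false i s.+1 j))
  (gf_sum j (fun s r => shape_growths r false i 0 s.+1)).
Qed.

(** The equations for e and e + 1 differ only in the term of C and in one further E term, which is
    again M(i,e+1,j). *)
Lemma Mgf_geometric i e j : (1 - 2 * X) * Mgf i e.+1 j = (1 - X) * Mgf i e j.
Proof.
have := MgfE i e.+1 j; have := MgfE i e j; rewrite big_ord_recr /=.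
set A := \sum_(t < i) _; set B := \sum_(s < j) _; set C := \sum_(s < e) _.
move: (Mgf i e j) (Mgf i e.+1 j) => m m' Em Em'.
have -> : (1 - 2 * X) * m' = m' - 2 * X * m' by ring.
have -> : (1 - X) * m = m - X * m by ring.
by rewrite {1}Em' {1}Em; ring.
Qed.

(** The equations of D and M differ only in the term of C, whence D(i,e,j) = (1 - x) M(i,e,j) + x
    D(i,e+1,j). Since M has ratio (1 - x)/(1 - 2x) in e, this sums to a geometric series of ratio
    x(1 - x)/(1 - 2x). Both sides are shown to be the same tail in e. *)
Lemma Dgf_Mgf i j : (1 - 3 * X + X ^+ 2) * Dgf i 0 j =
  (1 - X) * (1 - 2 * X) * Mgf i 0 j.
Proof.
pose f e := (1 - 3 * X + X ^+ 2) * ((1 - X) * Mgf i e j).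
transitivity (xtail f 0).
  apply: (xtail_unique (Q := fun e => (1 - 3 * X + X ^+ 2) * Dgf i e j)) => e.
  have := DgfE i e j; have := MgfE i e j; rewrite /f.
  set A := \sum_(t < i) _; set B := \sum_(s < j) _; set C := \sum_(s < e) _.
  move: (Mgf i e j) (Dgf i e j) (Dgf i e.+1 j) => m d d' Em ->.
  have -> : (1 - X) * m = m - X * m by ring.
  by rewrite {1}Em; ring.
apply/esym.
apply: (xtail_unique (Q := fun e => (1 - X) * (1 - 2 * X) * Mgf i e j)) => e.
by rewrite -[_ * Mgf i e.+1 j]mulrA Mgf_geometric /f; ring.
Qed.

(** Without N and E gaps, the equation contains only the term of C and a partial sum over the P
    gaps, which costs a factor 1/(1 - x) after summation over j. *)
Lemma Mgf_row0_sum : (1 - 3 * X + X ^+ 2) * xtail (fun j => Mgf 0 0 j.+1) 0 = 1.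
Proof.
set V := xtail _ 0.
have : V = xtail (fun=> 1) 0
    + X * (V + xtail (fun k => \sum_(t < k.+1) Mgf 0 0 t.+1) 0).
  rewrite -xtailD -xtailM -xtailD; apply: eq_xtail => j.
  by rewrite {1}MgfE !big_ord0 add0r addr0.
move/(congr1 ( *%R (1 - X))); rewrite mulrDr xtail1 mulrCA mulrDr.
rewrite (xtail_partial_sums (fun j => Mgf 0 0 j.+1)) -/V => E.
apply/eqP; rewrite -subr_eq0; apply/eqP.
transitivity ((1 - X) * V - (1 + X * ((1 - X) * V + V))); first by ring.
by rewrite -E subrr.
Qed.

Lemma Mgf_sum : (1 - X) * (1 - 3 * X) *
  xtail (fun i => xtail (fun j => Mgf i 0 j.+1) 0) 0 = 1.
Proof.
pose b i := xtail (fun j => Mgf i 0 j.+1) 0; set U := xtail _ 0.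
have bE i : (1 - X) * b i = 1 + X * ((1 - X) * (\sum_(t < i.+1) b t) + b i).
  have : b i = xtail (fun=> 1) 0 + X * (\sum_(t < i.+1) b t +
      xtail (fun k => \sum_(t < k.+1) Mgf i 0 t.+1) 0).
    rewrite -(xtail_sum i.+1 (fun t j => Mgf t 0 j.+1)) -xtailD -xtailM -xtailD.
    apply: eq_xtail => j.
    (* The term of C completes the sum over the N gaps t < i to a partial sum over t <= i, so the
       summation over i can proceed like that over j. *)
    by rewrite {1}MgfE big_ord0 addr0 [\sum_(t < i.+1) _]big_ord_recr.
  move/(congr1 ( *%R (1 - X))); rewrite mulrDr xtail1 mulrCA mulrDr.
  by rewrite (xtail_partial_sums (fun j => Mgf i 0 j.+1)).
have : (1 - X) * U = xtail (fun=> 1) 0 +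
    X * ((1 - X) * xtail (fun i => \sum_(t < i.+1) b t) 0 + U).
  rewrite -!xtailM -xtailD -xtailM -xtailD; apply: eq_xtail => i; exact: bE.
rewrite xtail_partial_sums -/U => /(congr1 ( *%R (1 - X))).
rewrite [RHS]mulrDr xtail1 => E.
apply/eqP; rewrite -subr_eq0; apply/eqP.
transitivity ((1 - X) * ((1 - X) * U) - (1 + (1 - X) * (X * (U + U)))).
  by ring.
by rewrite -E subrr.
Qed.

(** The first summand counts the decreasing words; x Z counts the others, the factor x standing for
    the letter that creates the first ascent. *)
Lemma gf_growths : exists Z,
  gf (fun n => growths n [::]) = xtail (fun=> 1) 0 + X * Z /\
  (1 - 3 * X + X ^+ 2) * Z = (1 - X) * (1 - 2 * X) *
   (xtail (fun i => xtail (fun j => Mgf i 0 j.+1) 0) 0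
    - xtail (fun j => Mgf 0 0 j.+1) 0).
Proof.
pose w n := iter n (append 0) [::].
have sw n : size (w n) = n by elim: n => //= n IHn; rewrite size_append IHn.
have Dw n : decreasing_shape (w n).
  by elim: n => [|n IHn]; [split | exact: decreasing_shape_append0].
pose Q n := gf (fun r => growths r (w n)).
pose z n := \sum_(v < n) Dgf v.+1 0 (n - v).
have QE n : Q n = (1 + X * z n) + X * Q n.+1.
  rewrite /Q (gf_cons (c' := fun r => (growths r (w n.+1)
    + \sum_(v < n) shape_growths r true v.+1 0 (n - v))%N)) //.
    rewrite gfD (gf_sum n (fun v r => shape_growths r true v.+1 0 (n - v))).
    by rewrite -/(z n); ring.
  by move=> r; rewrite growths_decreasing // sw.
exists (xtail z 0); split.
  by rewrite -/(Q 0%N) (xtail_unique QE) xtailD xtailM.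
rewrite -xtailM; set b := fun i => xtail (fun j => Mgf i 0 j.+1) 0.
(* The first ascent leaves i >= 1 N gaps, so the row i = 0 drops out of the double sum. The
   remaining factor X also appears on the left because [z 0] is an empty sum. *)
rewrite (xtailE b) -/(b 0%N) [b 0%N + _]addrC addrK -(xtail_shift b).
rewrite -(xtail_diagonal (fun v j => Mgf v.+1 0 j.+1)) xtailE.
rewrite {1}/z big_ord0 mulr0 add0r mulrCA; congr (_ * _).
rewrite -xtailM -xtail_shift; apply: eq_xtail => n.
rewrite !mulr_sumr; apply: eq_bigr => v _.
by rewrite Dgf_Mgf subSn // -ltnS.
Qed.

Theorem theorem10 :
  let T : seq (seq nat) := [:: [:: 1; 2; 4; 3]; [:: 3; 1; 4; 2]; [:: 3; 4; 1; 2]]%N in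
  let x : fps int := fpsX in
  avoid_gf T =
    (1 - 9 * x + 30 * x ^+ 2 - 44 * x ^+ 3 + 27 * x ^+ 4 - 7 * x ^+ 5)
    / ((1 - 3 * x) * (1 - x) * (1 - 3 * x + x ^+ 2) ^+ 2).
Proof.
move=> T x.
have -> : avoid_gf T = gf (fun n => growths n [::]).
  by apply: fpsP => n /=; rewrite card_avoiders.
have [Z [-> ZE]] := gf_growths.
have := Mgf_sum; have := Mgf_row0_sum; have := xtail1; move: ZE.
move: (xtail _ 0) (xtail _ 0) (xtail _ 0) => o V U; rewrite -/x => ZE oE VE UE.
set q := 1 - 3 * x + x ^+ 2 in ZE VE *.
have uD : (1 - 3 * x) * (1 - x) * q ^+ 2 \is a GRing.unit.
  have u a : 1 - x * a \is a GRing.unit by rewrite -mulrN unit_1DxM.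
  have uq : q \is a GRing.unit by rewrite (_ : q = 1 - x * (3 - x)) // /q; ring.
  by rewrite !unitrM uq -{2}[x]mulr1 (mulrC 3) !u.
apply: (canRL (mulrK uD)).
(* After clearing the denominator, the terms are grouped so that each unknown series occurs only
   within a product whose value is known. *)
transitivity ((1 - 3 * x) * q ^+ 2 * ((1 - x) * o)
  + x * (1 - 3 * x) * (1 - x) * q * (q * Z)); first by ring.
rewrite ZE oE.
transitivity ((1 - 3 * x) * q ^+ 2
  + x * (1 - x) * (1 - 2 * x) * (q * ((1 - x) * (1 - 3 * x) * U)
      - (1 - 3 * x) * (1 - x) * (q * V))); first by ring.
by rewrite UE VE /q; ring.
Qed.
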